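(* Let $G$ be a hereditarily collectionwise Hausdorff $T_1$ paratopological group with a suitable set $S$ and let $H$ be a sequentially dense subgroup of $G$. Then $H$ has a suitable set of size at most $|S|\cdot\aleph_0$.
   Context: A paratopological group is a group $G$ endowed with a topology such that the group operation $G\times G\to G$ is continuous (inversion need not be continuous). The identity is denoted by $e$. A subset $S$ of a paratopological group $G$ is a suitable set for $G$ if $S$ is a discrete subspace of $G$, $S\cup\{e\}$ is closed in $G$, and the subgroup $\langle S\rangle$ generated by $S$ is dense in $G$. Subgroups carry the subspace topology. A subset $D$ of a space $X$ is strongly discrete if each point $x\in D$ has a neighborhood $U_x$ such that the family $\{U_x:x\in D\}$ is discrete, that is, each point of $X$ has a neighborhood intersecting at most one set of the family. A space is collectionwise Hausdorff if each of its closed discrete subsets is strongly discrete; it is hereditarily collectionwise Hausdorff if each of its subspaces is collectionwise Hausdorff. A subset $D$ of a space $X$ is sequentially dense (in $X$) if each point $x\in X$ is a limit of a sequence of points of $D$. *)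

(* Defs.v *)
From HB Require Import structures.
From mathcomp Require Import all_boot all_classical topology.

Set Implicit Arguments.
Unset Strict Implicit.
Unset Printing Implicit Defensive.

Local Open Scope classical_set_scope.
Local Open Scope group_scope.

HB.structure Definition PreTopologicalGroup :=
  {G of Group G & Topological G}.

HB.mixin Record PreTopologicalGroup_isParatopological G
    & PreTopologicalGroup G := {
  mulg_continuous : continuous (fun xy : G * G => xy.1 * xy.2)
}.

#[short(type="paratopologicalGroupType")]
HB.structure Definition ParatopologicalGroup :=
  {G of PreTopologicalGroup G & PreTopologicalGroup_isParatopological G}.

Record subgroup_type (G : paratopologicalGroupType) (H : groupClosed G) :=
  SubgroupElt { subgroup_val :> G; _ : subgroup_val \in H }.

Section SubgroupInstances.
Context (G : paratopologicalGroupType) (H : groupClosed G).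

Lemma groupClosed_closed : group_closed H.
Proof.
split=> [|x y Hx Hy]; first exact: gpred1.
by apply: gpredM => //; rewrite gpredV.
Qed.

HB.instance Definition _ := [isSub for @subgroup_val G H].
HB.instance Definition _ := [Choice of subgroup_type H by <:].
HB.instance Definition _ :=
  SubChoice_isSubGroup.Build G _ (subgroup_type H) groupClosed_closed.
HB.instance Definition _ := Topological.copy (subgroup_type H)
  (initial_topology (@subgroup_val G H)).

Lemma subgroup_mulg_continuous :
  continuous (fun xy : subgroup_type H * subgroup_type H => xy.1 * xy.2).
Proof.
apply: continuous_comp_initial => -[x y].
pose f (xy : subgroup_type H * subgroup_type H) : G * G :=
  (subgroup_val xy.1, subgroup_val xy.2).
apply: (@continuous_comp _ _ _ f (fun xy => xy.1 * xy.2) (x, y)).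
  apply: cvg_pair => /=.
    apply: (@cvg_comp _ _ _ fst (@subgroup_val G H)); first exact: cvg_fst.
    exact: (@initial_continuous _ _ (@subgroup_val G H) x).
  apply: (@cvg_comp _ _ _ snd (@subgroup_val G H)); first exact: cvg_snd.
  exact: (@initial_continuous _ _ (@subgroup_val G H) y).
exact: mulg_continuous.
Qed.

HB.instance Definition _ := PreTopologicalGroup_isParatopological.Build
  (subgroup_type H) subgroup_mulg_continuous.
End SubgroupInstances.

Definition discrete_space (X : topologicalType) : Prop :=
  (@nbhs X X) = principal_filter.

(* The coercion of D to a type carries the subspace topology. *)
Definition discrete_subspace (X : topologicalType) (D : set X) : Prop :=
  discrete_space D.

(* The discrete family is the family (U x) indexed by x in D, not the mere set
   of its values: U x and U y count as two members when x != y. *)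
Definition strongly_discrete (X : topologicalType) (D : set X) : Prop :=
  exists2 U : X -> set X,
    (forall x, D x -> nbhs x (U x)) &
    forall z : X, exists2 V : set X, nbhs z V &
      forall x y, D x -> D y ->
        V `&` U x !=set0 -> V `&` U y !=set0 -> x = y.

Definition collectionwise_hausdorff (X : topologicalType) : Prop :=
  forall D : set X, closed D -> discrete_subspace D -> strongly_discrete D.

Definition hereditarily_collectionwise_hausdorff (X : topologicalType) : Prop :=
  forall A : set X, collectionwise_hausdorff A.

Definition sequentially_dense (X : topologicalType) (D : set X) : Prop :=
  forall x : X, exists2 u : nat -> X,
    (forall n, D (u n)) & u n @[n --> \oo] --> x.

Section SuitableSets.
Context {G : paratopologicalGroupType}.

Definition generated_subgroup (S : set G) : set G :=
  smallest [set A : set G | group_closed [in A]] S.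

Definition suitable_set (S : set G) : Prop :=
  [/\ discrete_subspace S, closed (S `|` [set 1]) &
      dense (generated_subgroup S)].

End SuitableSets.

(* Main.v *)
(* In the open subspace G \ {1} the set S \ {1} is closed and discrete, so its
   points x have neighborhoods U_x forming a discrete family there. For each x
   choose sequences u -> x and v -> x^-1 in H, constant if x is in H. The terms
   of u and u^2 v lying in U_x, for all x, form a set T. As G is Hausdorff, T is
   locally finite at each point of H \ {1}: a sequence attached to x can only
   accumulate at x, and it is constant when x is in H. The closure of <T> is a
   submonoid that contains S and, since v = u^-2 (u^2 v), also S^-1. *)
Require Import Defs.
From mathcomp Require Import all_boot all_classical topology.

Local Open Scope classical_set_scope.
Local Open Scope card_scope.

(** * Separation and discrete families in subspaces *)

Lemma nbhs_initialP (X : choiceType) (Y : topologicalType) (f : X -> Y)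
    (x : X) (U : set X) :
  @nbhs _ (initial_topology f) x U <->
  exists2 V, nbhs (f x) V & f @^-1` V `<=` U.
Proof.
split=> [|[V Vfx VU]].
  rewrite (@nbhsE (initial_topology f)) => -[_ [[W Wop <-] Wx] WU].
  by exists W => //; rewrite nbhsE; exists W.
by apply: filterS VU _; apply: (@initial_continuous _ _ f x).
Qed.

Lemma discrete_subspaceP (X : topologicalType) (D : set X) :
  discrete_subspace D <->
  forall x, D x -> exists2 V, nbhs x V & V `&` D `<=` [set x].
Proof.
split=> [dD x Dx|dD].
  have : nbhs (SigSub (mem_set Dx) : D) [set SigSub (mem_set Dx)].
    by rewrite [nbhs]dD; apply/principal_filterP.
  move=> /nbhs_initialP[V Vx VD]; exists V => // y [Vy Dy].
  by have /(_ Vy)/(congr1 val) := VD (SigSub (mem_set Dy)).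
rewrite /discrete_subspace /discrete_space; apply/funext => x; apply/seteqP.
split=> W; first by move=> /nbhs_singleton Wx; apply/principal_filterP.
move=> /principal_filterP Wx; apply/nbhs_initialP.
have [V Vx VD] := dD (val x) (set_valP x).
exists V => // y Vy; suff -> : y = x by [].
by apply: val_inj; apply: VD; split=> //; apply: set_valP.
Qed.

(** The trace of [D] on the subspace [A] is closed and discrete, so collectionwise Hausdorffness of
    [A] expands it. Openness of [A] turns neighborhoods in [A] into neighborhoods in [X];
    discreteness of the family is only obtained at points of [A]. *)
Lemma hereditarily_cwh_expansion (X : topologicalType) (A D : set X) :
  hereditarily_collectionwise_hausdorff X ->
  open A -> D `<=` A -> closed (D `|` ~` A) -> discrete_subspace D ->
  exists2 U : X -> set X,
    forall x, D x -> nbhs x (U x) /\ U x `<=` A &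
    forall z, A z -> exists2 V, nbhs z V &
      forall x y, D x -> D y ->
        V `&` U x !=set0 -> V `&` U y !=set0 -> x = y.
Proof.
move=> cwhX oA DA cD /discrete_subspaceP dD.
have cD' : closed ([set a : A | D (val a)]).
  have <- : val @^-1` (D `|` ~` A) = [set a : A | D (val a)].
    by apply/seteqP; split=> a; [case=> // /(_ (set_valP a))|left].
  by apply: preimage_closed => // a _; apply: initial_continuous.
have dD' : discrete_subspace [set a : A | D (val a)].
  apply/discrete_subspaceP => a Da; have [V Vx VD] := dD _ Da.
  exists (val @^-1` V); first by apply/nbhs_initialP; exists V.
  by move=> b [Vb Db]; apply: val_inj; apply: VD.
have [U Unbhs Udisc] := cwhX A _ cD' dD'.
(* The sets given on the subtype [A] are pushed forward to [X]; quantifying over [a] yields a value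
   at every [x], empty outside [A]. *)
exists (fun x => [set y | exists a b : A, [/\ val a = x, val b = y & U a b]]).
  move=> x Dx; split; last by move=> y [a [b [_ <- _]]]; exact: set_valP.
  pose a : A := SigSub (mem_set (DA _ Dx)).
  have /nbhs_initialP[V Vx VU] := Unbhs a Dx.
  apply: filterS (filterI Vx (open_nbhs_nbhs (conj oA (DA _ Dx)))).
  move=> y [Vy Ay]; exists a, (SigSub (mem_set Ay)); split=> //.
  exact: VU.
move=> z Az; have [W Wz WU] := Udisc (SigSub (mem_set Az)).
have /nbhs_initialP[V Vz VW] := Wz.
exists V => // x y Dx Dy.
move=> [x' [Vx' [a [p [ax px' Uap]]]]] [y' [Vy' [b [q [b_y qy' Ubq]]]]].
rewrite -ax -b_y; congr val; apply: WU.
- by rewrite /= ax.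
- by rewrite /= b_y.
- by exists p; split=> //; apply: VW; move: Vx'; rewrite -px'.
- by exists q; split=> //; apply: VW; move: Vy'; rewrite -qy'.
Qed.

(** A pair of distinct points is closed and discrete by T1, so it expands to a discrete family. If
    the points could not be separated, every neighborhood of [p] would meet both members. *)
Lemma hereditarily_cwh_hausdorff (X : topologicalType) :
  accessible_space X -> hereditarily_collectionwise_hausdorff X ->
  hausdorff_space X.
Proof.
move=> T1 cwhX p q pq; apply: contrapT => npq.
have closed1 := accessible_closed_set1 T1.
have [||||U Unbhs Udisc] :=
    @hereditarily_cwh_expansion X setT [set p; q] cwhX.
- exact: openT.
- by [].
- by rewrite setCT setU0; apply: closedU.
- apply/discrete_subspaceP => x _.
  exists (~` ([set p; q] `\ x)).
    apply: open_nbhs_nbhs; split; last by case=> _; apply.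
    rewrite openC; apply: (accessible_finite_set_closed.1 T1).
    exact/finite_setD/finite_set2.
  move=> y [nD Dy]; apply: contrapT => yx; exact: nD.
have [V Vp VU] := Udisc p I.
apply: npq; apply: VU; [by left|by right| |].
  exists p; split; first exact: nbhs_singleton.
  by apply: nbhs_singleton; apply: (Unbhs p _).1; left.
by apply: pq => //; apply: (Unbhs q _).1; right.
Qed.

(** A tail of [t] lies in a neighborhood of [x] disjoint from one of [z]. Indices are counted, so
    repeated values do no harm. *)
Lemma cvg_locally_finite (X : topologicalType) (t : nat -> X) (x z : X) :
  hausdorff_space X -> t @ \oo --> x -> z != x ->
  exists2 V, nbhs z V & finite_set [set n | V (t n)].
Proof.
rewrite open_hausdorff => hX tx /hX[[A B] /= [/set_mem Az /set_mem Bx]].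
move=> [oA oB /eqP AB0].
have [N _ NB] : \forall n \near \oo, B (t n).
  by apply: tx; apply: open_nbhs_nbhs.
exists A; first exact: open_nbhs_nbhs.
apply: (sub_finite_set _ (finite_II N)) => n /= An.
rewrite ltnNge; apply/negP => /NB Bn.
by have : (A `&` B) (t n) by []; rewrite AB0.
Qed.

(** In a T1 space finitely many points can be cut out of a neighborhood, so each [z != e] has one
    meeting [T] at most in [z]. This gives both conclusions. *)
Lemma locally_finite_discrete_closed (X : topologicalType) (e : X) (T : set X) :
  accessible_space X -> ~ T e ->
  (forall z, z != e -> exists2 V, nbhs z V & finite_set (V `&` T)) ->
  discrete_subspace T /\ closed (T `|` [set e]).
Proof.
move=> T1 nTe Tfin.
have fin_isolated z : z != e -> exists2 V, nbhs z V & V `&` T `<=` [set z].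
  move=> /Tfin[V Vz VT]; exists (V `&` ~` ((V `&` T) `\ z)).
    apply: filterI => //; apply: open_nbhs_nbhs; split; last by case=> _; apply.
    rewrite openC; apply: (accessible_finite_set_closed.1 T1).
    exact: finite_setD.
  by move=> y [[Vy nD] Ty]; apply: contrapT => yz; apply: nD.
split.
  apply/discrete_subspaceP => x Tx; apply: fin_isolated.
  by apply/eqP => xe; apply: nTe; rewrite -xe.
move=> z clz; apply: contrapT => nz.
have ze : z != e by apply/eqP => ze; apply: nz; right.
have [V Vz VT] := fin_isolated _ ze.
have ne : nbhs z (~` [set e]).
  apply: open_nbhs_nbhs; split; last exact/eqP.
  by rewrite openC; apply: accessible_closed_set1.
have [y [Ty [Vy ye]]] := clz _ (filterI Vz ne).
case: Ty => // Ty; apply: nz; left.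
by have <- : y = z by apply: VT.
Qed.

(** * Closures of submonoids and generated subgroups *)

Section GeneratedSubgroup.
Local Open Scope group_scope.
Context {G : paratopologicalGroupType}.
Implicit Types (A B : set G) (x y : G).

Lemma sub_generated_subgroup A : A `<=` generated_subgroup A.
Proof. by move=> x Ax B [_ /(_ _ Ax)]. Qed.

Lemma generated_subgroup_closed A : group_closed [in generated_subgroup A].
Proof.
split=> [|x y /set_mem Ax /set_mem Ay]; apply/mem_set => B BA.
  by apply/set_mem; case: BA.1.
apply/set_mem; apply: BA.1.2; apply/mem_set; [exact: Ax|exact: Ay].
Qed.

Lemma generated_subgroupM A x y :
  generated_subgroup A x -> generated_subgroup A y ->
  generated_subgroup A (x * y).
Proof.
move=> /mem_set Ax /mem_set Ay; apply/set_mem.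
exact: (group_closedM (generated_subgroup_closed A)).
Qed.

Lemma generated_subgroupV A x :
  generated_subgroup A x -> generated_subgroup A x^-1.
Proof.
move=> /mem_set Ax; apply/set_mem.
exact: (group_closedV (generated_subgroup_closed A)).
Qed.

Lemma generated_subgroup1 A : generated_subgroup A 1.
Proof. by apply/set_mem; have [] := generated_subgroup_closed A. Qed.

Lemma generated_subgroup_min A B :
  group_closed [in B] -> A `<=` B -> generated_subgroup A `<=` B.
Proof. by move=> gB AB x; apply. Qed.

Lemma closureM A x y : (forall a b, A a -> A b -> A (a * b)) ->
  closure A x -> closure A y -> closure A (x * y).
Proof.
move=> AM clx cly V /(mulg_continuous (x, y))[[P Q] /= [Px Qy] PQ].
have [a [Aa Pa]] := clx _ Px; have [b [Ab Qb]] := cly _ Qy.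
by exists (a * b); split; [exact: AM|exact: (PQ (a, b))].
Qed.

(* Inversion is not continuous, so the closure of a subgroup is only a
   submonoid: inverses have to be approximated separately. *)
Lemma generated_subgroup_sub_closure A B :
  B 1 -> (forall a b, B a -> B b -> B (a * b)) ->
  (forall x, A x -> closure B x) -> (forall x, A x -> closure B x^-1) ->
  generated_subgroup A `<=` closure B.
Proof.
move=> B1 BM AB AVB.
have cl1 : closure B 1 by apply: subset_closure.
(* Requiring the inverse to lie in the closure as well makes the submonoid a subgroup. *)
suff : generated_subgroup A `<=` closure B `&` [set x | closure B x^-1].
  by move=> sub x /sub[].
apply: generated_subgroup_min; last by move=> x Ax; split; [exact: AB|exact: AVB].
split=> [|x y /set_mem[x1 x2] /set_mem[y1 y2]]; apply/mem_set.
  by split=> //=; rewrite invg1.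
by split=> /=; rewrite ?invgM ?invgK; apply: closureM.
Qed.

End GeneratedSubgroup.

(** * Approximating elements and their inverses from the subgroup *)

Section DenseSubgroup.
Local Open Scope group_scope.
Context (G : paratopologicalGroupType) (H : groupClosed G).
Implicit Types x y : G.
Local Notation val := (@subgroup_val G H).

Lemma cvgM_seq (u v : nat -> G) x y :
  u @ \oo --> x -> v @ \oo --> y -> (fun n => u n * v n) @ \oo --> x * y.
Proof.
move=> ux vy; apply: (@cvg_comp _ _ _ (fun n => (u n, v n))
  (fun xy : G * G => xy.1 * xy.2) _ _ _ (cvg_pair ux vy)).
exact: (mulg_continuous (x, y)).
Qed.

Lemma seq_dense_lift x : sequentially_dense [set y | y \in H] ->
  exists2 u : nat -> subgroup_type H,
    val \o u @ \oo --> x & x \in H -> forall n, val (u n) = x.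
Proof.
move=> /(_ x)[u Hu ux]; have [xH|xH] := boolP (x \in H).
  by exists (fun=> SubgroupElt xH) => //; apply: cvg_cst.
by exists (fun n => SubgroupElt (Hu n)).
Qed.

(* If u -> x and v -> x^-1, then also u^2 v -> x, so the two sequences u and
   u^2 v converge to x and generate v. *)
Lemma seq_dense_generators x : sequentially_dense [set y | y \in H] ->
  exists t : nat -> subgroup_type H,
    [/\ val \o t @ \oo --> x,
        x \in H -> forall n, val (t n) = x &
        (fun n => val ((t n.*2 * t n.*2)^-1 * t n.*2.+1)) @ \oo --> x^-1].
Proof.
move=> dH; have [u ux uH] := seq_dense_lift x dH.
have [v vx vH] := seq_dense_lift x^-1 dH.
have wx : (fun n => val (u n) * val (u n) * val (v n)) @ \oo --> x.
  by have := cvgM_seq _ _ _ _ (cvgM_seq _ _ _ _ ux ux) vx; rewrite mulgK.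
(* Both sequences are interleaved into one: even terms are [u], odd terms are [u * u * v]. *)
exists (fun n => if odd n then u n./2 * u n./2 * v n./2 else u n./2); split.
- move=> V Vx; have [N _ NV] : \forall n \near \oo,
      V (val (u n)) /\ V (val (u n) * val (u n) * val (v n)).
    by apply: filterI; [exact: ux|exact: wx].
  exists N.*2 => // n /= Nn; have Nn2 : (N <= n./2)%N by rewrite geq_half_double.
  by rewrite /preimage /=; case: ifP => _; have [] := NV _ Nn2.
- move=> xH n; have xVH : x^-1 \in H by rewrite gpredV.
  case: ifP => _; last exact: uH.
  by rewrite /= uH // vH // mulgK.
- apply: cvg_trans vx; apply: near_eq_cvg; near=> n => /=.
  by rewrite odd_double doubleK /= uphalf_double mulKg.
Unshelve. all: by end_near. Qed.

End DenseSubgroup.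

(** * Construction of the suitable set of the subgroup *)

Theorem proposition5p3 (G : paratopologicalGroupType) (S : set G)
    (H : groupClosed G) :
  accessible_space G ->
  hereditarily_collectionwise_hausdorff G ->
  suitable_set S ->
  sequentially_dense [set x : G | x \in H] ->
  exists2 T : set (subgroup_type H),
    suitable_set T & T #<= S `*` [set: nat].
Proof.
move=> T1 cwhG [dS cS genS] dH.
have hG := hereditarily_cwh_hausdorff _ T1 cwhG.
have T1H : accessible_space (subgroup_type H).
  move=> h k hk; have [|A [oA hA kA]] := T1 (subgroup_val h) (subgroup_val k).
    by rewrite (inj_eq val_inj).
  exists (@subgroup_val G H @^-1` A); split.
  - by exists A.
  - by apply/mem_set/set_mem.
  - by apply/mem_set; apply: (set_mem kA).
(* [S] may contain [1]; removing it leaves [S] with [1] adjoined, a closed set, unchanged. *)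
pose D := S `\ 1%g.
have [||||U Unbhs Udisc] := @hereditarily_cwh_expansion G (~` [set 1%g]) D cwhG.
- by rewrite openC; apply: accessible_closed_set1.
- by move=> x [].
- suff -> : D `|` ~` ~` [set 1%g] = S `|` [set 1%g] by [].
  rewrite setCK; apply/seteqP; split=> x; first by case=> [[]|]; [left|right].
  by have [->|/eqP x1] := eqVneq x 1%g; [right|case=> // Sx; left].
- have /discrete_subspaceP {}dS := dS.
  apply/discrete_subspaceP => x [Sx _]; have [V Vx VS] := dS x Sx.
  by exists V => // y [Vy [Sy _]]; apply: VS.
have /choice[t tP] := fun x : G => @seq_dense_generators G H x dH.
pose T := [set h : subgroup_type H |
  exists x n, [/\ D x, U x (subgroup_val h) & h = t x n]].
have nT1 : ~ T 1%g.
  by move=> [x [n [Dx Ux1 _]]]; have [_ /(_ _ Ux1)] := Unbhs x Dx; apply.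
have Tfin z : z != 1%g -> exists2 V, nbhs z V & finite_set (V `&` T).
  move=> z1; have zv1 : ~ [set 1%g] (subgroup_val z).
    by move=> /= zv1; move/eqP: z1; apply; apply: val_inj.
  have [V Vz VU] := Udisc _ zv1.
  have nbhs_lift W : nbhs (subgroup_val z) W ->
      nbhs z (@subgroup_val G H @^-1` W).
    by move=> Wz; apply/nbhs_initialP; exists W.
  (* Either [V] misses every [U x], hence [T], or it meets exactly one, and then [V] contains only
     terms of [t x] among the points of [T]. *)
  have [[x [Dx VUx]]|nx] :=
    pselect (exists x, D x /\ V `&` U x !=set0); last first.
    exists (@subgroup_val G H @^-1` V); first exact: nbhs_lift.
    suff -> : @subgroup_val G H @^-1` V `&` T = set0 by [].
    apply/seteqP; split=> // h [Vh [x [n [Dx Uh _]]]]; apply: nx.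
    by exists x; split=> //; exists (subgroup_val h).
  have VT h : V (subgroup_val h) -> T h -> exists n, h = t x n.
    move=> Vh [y [n [Dy Uh ->]]]; exists n; congr (t _ n).
    by apply: VU => //; exists (subgroup_val h).
  have [tx txH _] := tP x.
  (* If [z] is [x], then [x] lies in [H] and [t x] is constant; otherwise [t x] enters some
     neighborhood of [z] only finitely often. *)
  have [zx|zx] := eqVneq (subgroup_val z) x.
    exists (@subgroup_val G H @^-1` V); first exact: nbhs_lift.
    apply: (sub_finite_set _ (finite_set1 z)) => h [Vh /(VT _ Vh)[n ->]] /=.
    by apply: val_inj; rewrite /= txH // -zx; apply: valP.
  have [W Wz Wfin] := cvg_locally_finite _ _ _ _ hG tx zx.
  exists (@subgroup_val G H @^-1` (V `&` W)).
    by apply: nbhs_lift; apply: filterI.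
  apply: (sub_finite_set _ (finite_image (t x) Wfin)).
  by move=> h [[Vh Wh] /(VT _ Vh)[n hn]]; exists n; rewrite /= -?hn.
have [dT cT] := locally_finite_discrete_closed _ _ _ T1H nT1 Tfin.
exists T; last first.
  apply: (@card_le_trans _ _ _ ([set t p.1 p.2 | p in S `*` [set: nat]])).
    apply: subset_card_le => h [x [n [[Sx _] _ ->]]].
    by exists (x, n).
  exact: card_image_le.
split=> // O [h Oh] /= [O' oO' OO'].
(* Density is checked in [G]: it suffices that the closure of the image [B] contains the dense
   subgroup generated by [S]. *)
pose B := @subgroup_val G H @` generated_subgroup T.
have TU x n : D x -> U x (subgroup_val (t x n)) -> generated_subgroup T (t x n).
  by move=> Dx Ux; apply: sub_generated_subgroup; exists x, n.
have B1 : B 1%g by exists 1%g => //; exact: generated_subgroup1.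
have SB : generated_subgroup S `<=` closure B.
  have Ut x : D x -> \forall n \near \oo, U x (subgroup_val (t x n)).
    by move=> Dx; have [tx _ _] := tP x; apply: tx; have [] := Unbhs x Dx.
  apply: generated_subgroup_sub_closure => //.
  - move=> _ _ [a Ta <-] [b Tb <-]; exists (a * b)%g => //.
    exact: generated_subgroupM.
  - move=> x Sx; have [->|/eqP x1] := eqVneq x 1%g; first exact: subset_closure.
    have Dx : D x by [].
    move=> V Vx; have [tx _ _] := tP x.
    have [N _ NV] : \forall n \near \oo,
        V (subgroup_val (t x n)) /\ U x (subgroup_val (t x n)).
      by apply: filterI; [exact: tx|exact: Ut].
    have [VN UN] := NV N (leqnn N).
    by exists (subgroup_val (t x N)); split=> //; exists (t x N) => //; apply: TU.
  - move=> x Sx; have [->|/eqP x1] := eqVneq x 1%g.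
      by rewrite invg1; apply: subset_closure.
    have Dx : D x by [].
    move=> V Vx; have [_ _ vx] := tP x.
    have [N _ NV] := vx _ Vx.
    have [M _ MU] := Ut _ Dx.
    (* [N] serves the approximation of [x^-1]; [M] puts both terms, of indices [n.*2] and [n.*2.+1],
       into [U x] and hence into [T]. *)
    pose n := maxn N M.
    have Mn : (M <= n.*2)%N by rewrite (leq_trans (leq_maxr N M)) // -addnn leq_addr.
    exists (subgroup_val ((t x n.*2 * t x n.*2)^-1 * t x n.*2.+1)%g); split.
      eexists; last reflexivity.
      apply: generated_subgroupM; first apply: generated_subgroupV.
        by apply: generated_subgroupM; apply: TU => //; apply: MU.
      by apply: TU => //; apply: MU; apply: leqW.
    by apply: NV; apply: leq_maxl.
have [|y [Oy /SB yB]] := genS O' _ oO'.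
  by exists (subgroup_val h); rewrite -OO' in Oh.
have [_ [[k Tk <-] Ok]] := yB O' (open_nbhs_nbhs (conj oO' Oy)).
by exists k; split=> //; rewrite -OO'.
Qed.
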